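(* Let $q\in\{1,2\}$. Assume there exist $M_X,M_Y<\infty$ with $\max_{l\in[p]}\mathbb{E}[X_l^4]\le M_X^4$ and $\mathbb{E}[Y^2]\le M_Y^2$. Consider the projected gradient descent iterates $$\beta^{(k+1)}=\Pi_{\mathcal{B}_M}\big(\beta^{(k)}-\alpha\nabla\mathcal{J}_\gamma(\beta^{(k)})\big),\qquad k=0,1,2,\dots,$$ with stepsize $\alpha>0$ and initialization $\beta^{(0)}=0$. Then any accumulation point $\beta^*$ of the iterates $\{\beta^{(k)}\}_{k\in\mathbb{N}}$ must satisfy $\beta^*_{S^c}=0$.
   Context: Model: $(X,Y)\in\mathbb{R}^p\times\mathbb{R}$ with $\mathbb{E}[Y]=0$ and $Y=f^*(X_S)+\xi$, $\mathbb{E}[\xi|X]=0$. The signal set $S\subseteq[p]$ is the unique minimal subset such that (1) $\mathbb{E}[Y|X]=\mathbb{E}[Y|X_S]$ and (2) $X_S$ is independent of $X_{S^c}$. $v_S$ denotes restriction of a vector to the index set $S$. Kernel: $h(x)=\int_0^\infty e^{-tx}\mu(dt)$ with $\mu$ a finite nonnegative measure on $[0,\infty)$, $\mu((0,\infty))>0$; it is assumed that (i) $\int_0^\infty t^{-1}\mu(dt)<\infty$, (ii) $\mathrm{supp}(\mu)$ is compact, (iii) if $q=2$, $0\notin\mathrm{supp}(\mu)$. The kernel is $k(x,x')=h(\|x-x'\|_q^q)$ on $\mathbb{R}^p$ and $\mathcal{H}$ is its RKHS. Objective: for $\beta\in\mathbb{R}_+^p$, $\beta^{1/q}\odot x=(\beta_i^{1/q}x_i)_{i}$,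 and with $\lambda>0$, $\gamma\ge0$, $$\mathcal{J}(\beta)=\min_{f\in\mathcal{H}}\tfrac12\mathbb{E}[(Y-f(\beta^{1/q}\odot X))^2]+\tfrac\lambda2\|f\|_{\mathcal{H}}^2,\qquad \mathcal{J}_\gamma(\beta)=\mathcal{J}(\beta)+\gamma\|\beta\|_1.$$ Gradients are coordinatewise partial derivatives (right derivatives when $\beta_l=0$). $\mathcal{B}_M=\{\beta\in\mathbb{R}_+^p:\|\beta\|_1\le M\}$, $M\geq 0$ finite, and $\Pi_{\mathcal{B}_M}$ is the Euclidean projection onto $\mathcal{B}_M$. *)

(* Defs.v *)
From HB Require Import structures.
From mathcomp Require Import all_boot all_order all_algebra.
From mathcomp Require Import all_classical all_reals all_analysis.

Set Implicit Arguments.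
Unset Strict Implicit.
Unset Printing Implicit Defensive.

Import Order.TTheory GRing.Theory Num.Theory.
Import numFieldNormedType.Exports.

Local Open Scope classical_set_scope.
Local Open Scope ring_scope.

Section model.
Context (d : measure_display) (T : measurableType d) (R : realType).
Context (P : probability T R) (p : nat) (X : 'I_p -> {RV P >-> R}).

Definition rvec (w : T) : 'rV[R]_p := \row_i X i w.

(* X_A, the coordinates in A being listed in increasing order. *)
Definition subvec (A : {set 'I_p}) (w : T) : #|A|.-tuple R :=
  [tuple X (enum_val j) w | j < #|A|].

(* sigma(X_A); sigma(X) is the case A = [set: 'I_p]. *)
Definition sigma_subvec (A : {set 'I_p}) : set (set T) :=
  g_sigma_algebra_preimage (subvec A).

(* Z is a version of E[Y | G], for a sub-sigma-algebra G. *)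
Definition is_cond_expectation (G : set (set T)) (Y Z : T -> R) : Prop :=
  [/\ P.-integrable setT (EFin \o Y),
      g_sigma_algebra_preimage Z `<=` G,
      P.-integrable setT (EFin \o Z) &
      forall A, G A ->
        (\int[P]_(w in A) (Z w)%:E = \int[P]_(w in A) (Y w)%:E)%E].

(* E[Y | X] = E[Y | X_A] almost surely. *)
Definition mean_sufficient (Y : T -> R) (A : {set 'I_p}) : Prop :=
  exists Z Z' : T -> R,
    [/\ is_cond_expectation (sigma_subvec [set: 'I_p]%SET) Y Z,
        is_cond_expectation (sigma_subvec A) Y Z' &
        {ae P, forall w, Z w = Z' w}].

Definition indep_compl (A : {set 'I_p}) : Prop :=
  forall B C, sigma_subvec A B -> sigma_subvec (~: A)%SET C ->
    (P (B `&` C) = P B * P C)%E.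

Definition signal_minimal (Y : T -> R) (A : {set 'I_p}) : bool :=
  minset (fun B => `[< mean_sufficient Y B /\ indep_compl B >]) A.

Definition is_signal_set (Y : T -> R) (S : {set 'I_p}) : Prop :=
  signal_minimal Y S /\ forall S', signal_minimal Y S' -> S' = S.

End model.

Section kernel.
Context (R : realType).

Definition msupport (mu : {finite_measure set R -> \bar R}) : set R :=
  [set t | forall U : set R, open_nbhs t U -> (0 < mu U)%E].

Definition kernel_profile (mu : {finite_measure set R -> \bar R}) (x : R) : R :=
  \int[mu]_(t in `[0, +oo[) expR (- (t * x)).

Definition lq_kernel (mu : {finite_measure set R -> \bar R}) (q p : nat)
    (x y : 'rV[R]_p) : R :=
  kernel_profile mu (\sum_i `|x 0 i - y 0 i| ^+ q).

(* The RKHS of k, unique up to isometry: a Hilbert space whose elements are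
   identified with functions on E through the injective map rkhs_eval;
   rkhs_section x stands for the function k(x, .). *)
Record rkhs (E : Type) (k : E -> E -> R) := Rkhs {
  rkhs_space :> completeNormedModType R ;
  rkhs_dot : rkhs_space -> rkhs_space -> R ;
  rkhs_eval : rkhs_space -> E -> R ;
  rkhs_section : E -> rkhs_space ;
  rkhs_dotC : forall f g, rkhs_dot f g = rkhs_dot g f ;
  rkhs_dot_linear : forall g, scalar (fun f => rkhs_dot f g) ;
  rkhs_dot_norm : forall f, rkhs_dot f f = `|f| ^+ 2 ;
  rkhs_eval_linear : forall x, scalar (fun f => rkhs_eval f x) ;
  rkhs_eval_inj : injective rkhs_eval ;
  rkhs_sectionE : forall x y, rkhs_eval (rkhs_section x) y = k x y ;
  rkhs_reproducing : forall f x, rkhs_eval f x = rkhs_dot f (rkhs_section x)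
}.

End kernel.

Section optimization.
Context (R : realType) (p : nat).
Implicit Types (b x : 'rV[R]_p) (F : 'rV[R]_p -> R).

Definition scale_vec (q : nat) b x : 'rV[R]_p :=
  \row_i (b 0 i `^ q%:R^-1 * x 0 i).

Definition l1norm b : R := \sum_i `|b 0 i|.

Definition l2norm b : R := Num.sqrt (\sum_i b 0 i ^+ 2).

Definition l1ball_nonneg (M : R) : set 'rV[R]_p :=
  [set b : 'rV[R]_p | (forall i, 0 <= b 0 i) /\ l1norm b <= M].

Definition euclidean_proj (C : set 'rV[R]_p) x : 'rV[R]_p :=
  get [set b : 'rV[R]_p | C b /\ forall c, C c -> l2norm (x - b) <= l2norm (x - c)].

(* F matters only on the nonnegative orthant, hence the right derivative at
   its boundary. *)
Definition partial_deriv F b (l : 'I_p) : R :=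
  if b 0 l == 0
  then lim (h^-1 * (F (b + h *: delta_mx 0 l) - F b) @[h --> 0^'+])
  else 'D_(delta_mx 0 l) F b.

Definition gradient F b : 'rV[R]_p := \row_l partial_deriv F b l.

End optimization.

Section objective.
Context (d : measure_display) (T : measurableType d) (R : realType).
Context (P : probability T R) (p : nat).
Context (X : 'I_p -> {RV P >-> R}) (Y : T -> R).
Context (q : nat) (k : 'rV[R]_p -> 'rV[R]_p -> R) (H : rkhs k).

Definition krr_risk (lambda : R) (b : 'rV[R]_p) (f : H) : R :=
  2^-1 * fine 'E_P[fun w => (Y w - rkhs_eval f (scale_vec q b (rvec X w))) ^+ 2]
  + lambda / 2 * `|f| ^+ 2.

(* The minimum over f is attained (strong convexity), so it is the infimum. *)
Definition objJ (lambda : R) (b : 'rV[R]_p) : R :=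
  inf [set krr_risk lambda b f | f in [set: H]].

Definition objJ_gamma (lambda gamma : R) (b : 'rV[R]_p) : R :=
  objJ lambda b + gamma * l1norm b.

End objective.

(* Main.v *)
(* The iterates never leave [beta_(S^c) = 0]. If [b] vanishes off [S], [l] is not
   in [S] and [h > 0], then [J (b + h e_l) >= J b]: given [f], independence of
   [X_S] and [X_l], together with [E[Y|X] = E[Y|X_S]], makes the mean squared
   error of [f] at [b + h e_l] an average over the values [u] of [X_l] of the
   errors obtained with [X_l] frozen at [u]; freezing [X_l] amounts to evaluating
   at [b] a translate of [f], which has the same norm because the kernel is
   translation invariant. Hence the [l]-th partial derivative is nonnegative,
   and the projection keeps [beta_l = 0]. *)
Require Import Defs.
From HB Require Import structures.
From mathcomp Require Import all_boot all_order all_algebra.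
From mathcomp Require Import all_classical all_reals all_analysis.
From mathcomp Require Import measurable_realfun.
From mathcomp Require Import ring lra.
Import Order.TTheory GRing.Theory Num.Theory.
Import numFieldNormedType.Exports.
Local Open Scope classical_set_scope.
Local Open Scope ring_scope.
Import HBSimple.

Set Implicit Arguments.
Unset Strict Implicit.
Unset Printing Implicit Defensive.

(** * Reproducing kernel Hilbert spaces *)

Section rkhs_theory.
Context {R : realType} {E : Type} {k : E -> E -> R} {H : rkhs k}.
Implicit Types (f g : H) (s : seq (R * E)) (x y : E).

Lemma rkhs_dotDl f1 f2 g :
  rkhs_dot (f1 + f2) g = rkhs_dot f1 g + rkhs_dot f2 g.
Proof. by rewrite -[f1]scale1r (rkhs_dot_linear g 1) mul1r scale1r. Qed.

Lemma rkhs_dot0l g : rkhs_dot 0 g = 0.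
Proof.
apply/eqP; have /eqP := rkhs_dotDl 0 0 g.
by rewrite addr0 -subr_eq0 opprD addrA subrr sub0r oppr_eq0.
Qed.

Lemma rkhs_dotZl c f g : rkhs_dot (c *: f) g = c * rkhs_dot f g.
Proof. by rewrite -[c *: f]addr0 (rkhs_dot_linear g c) rkhs_dot0l addr0. Qed.

Lemma rkhs_dotBl f1 f2 g :
  rkhs_dot (f1 - f2) g = rkhs_dot f1 g - rkhs_dot f2 g.
Proof. by rewrite rkhs_dotDl -scaleN1r rkhs_dotZl mulN1r. Qed.

Lemma rkhs_normB f g :
  `|f - g| ^+ 2 = `|f| ^+ 2 - 2 * rkhs_dot f g + `|g| ^+ 2.
Proof.
rewrite -!rkhs_dot_norm rkhs_dotBl ![rkhs_dot _ (f - g)]rkhs_dotC !rkhs_dotBl.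
by rewrite (rkhs_dotC g f); ring.
Qed.

Lemma rkhs_norm_section x : `|rkhs_section H x| ^+ 2 = k x x.
Proof. by rewrite -rkhs_dot_norm -rkhs_reproducing rkhs_sectionE. Qed.

(** The residual of [f] after projection onto the line spanned by [g] has nonnegative squared
    norm. *)
Lemma rkhs_cauchy_schwarz f g : `|rkhs_dot f g| <= `|f| * `|g|.
Proof.
have [->|g0] := eqVneq g 0; first by rewrite rkhs_dotC rkhs_dot0l !normr0 mulr0.
have gp : 0 < `|g| by rewrite normr_gt0.
have := sqr_ge0 `|f - (rkhs_dot f g / `|g| ^+ 2) *: g|.
rewrite rkhs_normB (rkhs_dotC f) rkhs_dotZl normrZ exprMn real_normK ?num_real//.
rewrite (rkhs_dotC g f).
set a := rkhs_dot f g => ineq.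
rewrite -(@ler_pXn2r _ 2) ?nnegrE ?mulr_ge0// real_normK ?num_real//.
rewrite exprMn -ler_pdivrMr ?exprn_gt0// -subr_ge0.
apply: le_trans ineq _; rewrite le_eqVlt; apply/orP; left; apply/eqP.
by field; rewrite lt0r_neq0.
Qed.

Lemma rkhs_eval_le f x : `|rkhs_eval f x| <= `|f| * Num.sqrt (k x x).
Proof.
rewrite rkhs_reproducing (le_trans (rkhs_cauchy_schwarz _ _))//.
by rewrite -rkhs_norm_section sqrtr_sqr normr_id.
Qed.

Lemma rkhs_evalB f g x : rkhs_eval (f - g) x = rkhs_eval f x - rkhs_eval g x.
Proof. by rewrite !rkhs_reproducing rkhs_dotBl. Qed.

Lemma rkhs_kC x y : k x y = k y x.
Proof. by rewrite -!(rkhs_sectionE H) !rkhs_reproducing rkhs_dotC. Qed.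

(** The square root is the norm of the difference of the sections at [x] and [y]. *)
Lemma rkhs_eval_lipschitz f x y :
  `|rkhs_eval f x - rkhs_eval f y| <=
    `|f| * Num.sqrt (k x x - 2 * k x y + k y y).
Proof.
rewrite !rkhs_reproducing ![rkhs_dot f _]rkhs_dotC -rkhs_dotBl.
rewrite (le_trans (rkhs_cauchy_schwarz _ _))// mulrC ler_wpM2l//.
rewrite -!rkhs_norm_section -(rkhs_sectionE H) rkhs_reproducing -rkhs_normB.
by rewrite sqrtr_sqr normr_id.
Qed.

Lemma rkhs_cvg_seq (u : nat -> H) (e : nat -> R) : e n @[n --> \oo] --> 0 ->
  (forall n m, `|u n - u m| <= e n + e m) -> cvgn u.
Proof.
move=> e0 ue; apply: cauchy_cvg; apply: cauchy_exP => eps eps0.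
have /cvgrPdist_lt/(_ (eps / 2)) := e0.
rewrite divr_gt0// => /(_ isT)[N _ Ne]; exists (u N).
exists N => // n /= Nn; rewrite -ball_normE/=.
apply: le_lt_trans (ue _ _) _.
have := Ne N (leqnn N); have := Ne n Nn; rewrite /= !sub0r !normrN.
move=> /ltr_normlW ? /ltr_normlW ?; lra.
Qed.

(** Base points may repeat in [s], so that sums of combinations are concatenations. *)
Definition section_comb s : H := \sum_(cx <- s) cx.1 *: rkhs_section H cx.2.

Lemma section_comb_cat s t :
  section_comb (s ++ t) = section_comb s + section_comb t.
Proof. by rewrite /section_comb big_cat. Qed.

Lemma section_combZ c s :
  section_comb [seq (c * cx.1, cx.2) | cx <- s] = c *: section_comb s.
Proof.
rewrite /section_comb big_map scaler_sumr.
by apply: eq_bigr => i _ /=; rewrite scalerA.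
Qed.

Lemma section_combB s t :
  section_comb s - section_comb t =
  section_comb (s ++ [seq (-1 * cx.1, cx.2) | cx <- t]).
Proof. by rewrite section_comb_cat section_combZ scaleN1r. Qed.

Lemma rkhs_dot_comb f s :
  rkhs_dot (section_comb s) f = \sum_(cx <- s) cx.1 * rkhs_eval f cx.2.
Proof.
elim: s => [|a s IH]; first by rewrite /section_comb !big_nil rkhs_dot0l.
rewrite -cat1s section_comb_cat rkhs_dotDl IH big_cons.
by rewrite /section_comb big_seq1 rkhs_dotZl rkhs_dotC -rkhs_reproducing.
Qed.

Lemma rkhs_eval_comb s y :
  rkhs_eval (section_comb s) y = \sum_(cx <- s) cx.1 * k cx.2 y.
Proof.
rewrite rkhs_reproducing rkhs_dot_comb.
by apply: eq_bigr => i _; rewrite rkhs_sectionE rkhs_kC.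
Qed.

(** Combinations that minimise the distance to [f] leave Cauchy residuals. Their limit is orthogonal
    to every section, so it evaluates to 0 everywhere and is 0 by [rkhs_eval_inj]. *)
Lemma section_comb_dense f (e : R) : 0 < e -> exists s, `|f - section_comb s| < e.
Proof.
pose D := [set r | exists s, r = `|f - section_comb s| ^+ 2].
have D0 : D !=set0 by exists (`|f - section_comb [::]| ^+ 2), [::].
have Dlb : has_lbound D by exists 0 => _ [s ->]; rewrite sqr_ge0.
have infle s : inf D <= `|f - section_comb s| ^+ 2 by apply: ge_inf => //; exists s.
have /choice[s sE] : forall n : nat, exists s,
    `|f - section_comb s| ^+ 2 < inf D + n.+1%:R^-1.
  move=> n.
  have [//|_ [s ->] lts] := @inf_adherent _ D n.+1%:R^-1 _ (conj D0 Dlb).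
  by exists s.
pose u n := f - section_comb (s n).
pose a n : R := n.+1%:R^-1.
have a_gt0 n : 0 < a n by rewrite invr_gt0.
have a0 : a n @[n --> \oo] --> 0 := cvg_harmonic.
have sa0 : Num.sqrt (2 * a n) @[n --> \oo] --> 0.
  rewrite -[X in _ --> X]sqrtr0; apply: continuous_cvg; first exact: sqrt_continuous.
  by rewrite -[X in _ --> X](mulr0 2); apply: cvgM => //; exact: cvg_cst.
(* parallelogram law *)
have uE n m : `|u n - u m| <= Num.sqrt (2 * a n) + Num.sqrt (2 * a m).
  rewrite -(@ler_pXn2r _ 2) ?nnegrE ?addr_ge0 ?sqrtr_ge0//.
  apply: (@le_trans _ _ (2 * a n + 2 * a m)); last first.
    rewrite sqrrD !sqr_sqrtr ?mulr_ge0 ?(ltW (a_gt0 _))//.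
    by rewrite -addrA lerD2l lerDr mulrn_wge0 ?mulr_ge0 ?sqrtr_ge0.
  (* The midpoint of two combinations is a combination, so [inf D] bounds its squared distance to
     [f] from below. *)
  have := infle [seq (2^-1 * cx.1, cx.2) | cx <- s n ++ s m].
  rewrite section_combZ section_comb_cat.
  have -> : f - 2^-1 *: (section_comb (s n) + section_comb (s m)) =
      2^-1 *: (u n - (-1) *: u m).
    rewrite scaleN1r opprK /u addrACA -opprD scalerBr; congr (_ - _).
    by rewrite -[f + f]mulr2n -[f *+ 2]scaler_nat scalerA mulVf ?scale1r ?pnatr_eq0.
  rewrite normrZ exprMn !(rkhs_normB (u n)) (rkhs_dotC (u n) (-1 *: _)) rkhs_dotZl normrZ.
  rewrite (rkhs_dotC (u m)) normrN1 mul1r ger0_norm//.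
  have := sE n; have := sE m; rewrite -/(u n) -/(u m) -/(a n) -/(a m).
  by move=> ? ? ?; lra.
have /cvg_ex[/= v uv] : cvgn u by exact: rkhs_cvg_seq sa0 uE.
have v0 : v = 0.
  apply: (@rkhs_eval_inj _ _ _ H); apply/funext => x; rewrite !rkhs_reproducing rkhs_dot0l.
  have du : rkhs_dot (u n) (rkhs_section H x) @[n --> \oo] -->
      rkhs_dot v (rkhs_section H x).
    apply/cvgrPdistC_le => eps eps0; near=> n.
    rewrite -rkhs_dotBl (le_trans (rkhs_cauchy_schwarz _ _))//.
    rewrite (@le_trans _ _ (`|u n - v| * (`|rkhs_section H x| + 1)))//.
      by rewrite ler_wpM2l// lerDl.
    rewrite -ler_pdivlMr ?ltr_wpDl//; near: n.
    by apply: cvgr_distC_le => //; rewrite divr_gt0 ?ltr_wpDl.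
  set d := rkhs_dot v _ in du *; set K := `|rkhs_section H x| ^+ 2.
  have K0 : 0 <= K by rewrite sqr_ge0.
  have dK n : rkhs_dot (u n) (rkhs_section H x) ^+ 2 <= (K + 1) * a n.
    (* Near-minimality of [s n] is tested against adding [t] times the section at [x]. The optimal
       [t] would be [dn / K]; the denominator [K + 1] stays positive even if the section is 0. *)
    set dn := rkhs_dot _ _; pose t := dn / (K + 1).
    have := infle (s n ++ [:: (t, x)]).
    rewrite section_comb_cat opprD addrA {2}/section_comb big_seq1 -/(u n).
    rewrite rkhs_normB (rkhs_dotC (u n)) rkhs_dotZl rkhs_dotC -/dn normrZ exprMn.
    rewrite real_normK ?num_real// -/K /= => le1.
    have := sE n; rewrite -/(u n) -/(a n) => lt1.

    have tE : dn = t * (K + 1) by rewrite /t divfK// gt_eqF// ltr_wpDl.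
    have t2 : 0 <= t ^+ 2 by rewrite sqr_ge0.
    have an : dn * t <= a n.
      have tdn : t * dn = t ^+ 2 * K + t ^+ 2 by rewrite tE; ring.
      by rewrite mulrC; move: le1; rewrite tdn; lra.
    have -> : dn ^+ 2 = (K + 1) * (dn * t) by rewrite tE; ring.
    by rewrite ler_wpM2l// addr_ge0.
  apply/eqP; rewrite -sqrf_eq0 eq_le sqr_ge0 andbT.
  have d2 : rkhs_dot (u n) (rkhs_section H x) ^+ 2 @[n --> \oo] --> d ^+ 2.
    by rewrite expr2; under eq_fun do rewrite expr2; exact: cvgM.
  have Ka0 : (K + 1) * a n @[n --> \oo] --> 0.
    by rewrite -[X in _ --> X](mulr0 (K + 1)); apply: cvgM => //; exact: cvg_cst.
  by apply: ler_cvg_to d2 Ka0 _; near=> n.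
move=> e0; have := uv; rewrite v0 => /cvgr0_norm_lt/(_ _ e0)[N _ Ne].
by exists (s N); exact: (Ne N (leqnn N)).
Unshelve. all: by end_near.
Qed.

(* [s'] is the adjoint of [s] for the kernel: on finite combinations of
   sections, [f \o s'] comes from moving the base points by [s], an isometry. *)
Lemma rkhs_precomp (s s' : E -> E) f :
    (forall x y, k (s x) (s y) = k x y) -> (forall x y, k (s x) y = k x (s' y)) ->
  exists g : H, `|g| = `|f| /\ forall y, rkhs_eval g y = rkhs_eval f (s' y).
Proof.
move=> kss kss'.
pose m (t : seq (R * E)) := [seq (cx.1, s cx.2) | cx <- t].
have evalm t y : rkhs_eval (section_comb (m t)) y = rkhs_eval (section_comb t) (s' y).
  by rewrite !rkhs_eval_comb big_map; apply: eq_bigr => i _; rewrite kss'.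
have normm t : `|section_comb (m t)| = `|section_comb t|.
  apply/eqP; rewrite -(@eqrXn2 _ 2)// -!rkhs_dot_norm !rkhs_dot_comb big_map; apply/eqP.
  apply: eq_bigr => i _ /=; congr (_ * _); rewrite !rkhs_eval_comb big_map.
  by apply: eq_bigr => j _ /=; rewrite kss.
pose a n : R := n.+1%:R^-1.
have a0 : a n @[n --> \oo] --> 0 := cvg_harmonic.
have /choice[t tE] : forall n, exists t, `|f - section_comb t| < a n.
  by move=> n; apply: section_comb_dense; rewrite invr_gt0.
have tcvg : section_comb (t n) @[n --> \oo] --> f.
  apply/cvgrPdist_lt => e e0; near=> n; apply: lt_trans (tE n) _; near: n.
  have /cvgr0_norm_lt/(_ _ e0) := a0; apply: filterS => n /=; exact: ltr_normlW.
(* Moving base points preserves norms, so the moved combinations are Cauchy along with the original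
   ones. *)
have /cvg_ex[/= g gE] : cvgn (fun n => section_comb (m (t n))).
  apply: (rkhs_cvg_seq a0) => i j.
  have -> : section_comb (m (t i)) - section_comb (m (t j)) =
      section_comb (m (t i ++ [seq (-1 * cx.1, cx.2) | cx <- t j])).
    by rewrite section_combB /m map_cat -!map_comp.
  rewrite normm -section_combB.
  rewrite -[X in `|X|](subrKA f) (le_trans (ler_normD _ _))// distrC.
  by rewrite lerD// ltW.
exists g; split.
  have ng : `|section_comb (t n)| @[n --> \oo] --> `|g|.
    by under eq_fun do rewrite -normm; exact: cvg_norm.
  by apply: (norm_cvg_unique ng); exact: cvg_norm.
(* Norm convergence implies pointwise convergence, which carries [evalm] to the limits [g] and
   [f]. *)
have eval_cvg (v : nat -> H) (l : H) y : v n @[n --> \oo] --> l ->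
    rkhs_eval (v n) y @[n --> \oo] --> rkhs_eval l y.
  move=> vl; apply/cvgrPdistC_le => e e0; near=> n.
  rewrite -rkhs_evalB (le_trans (rkhs_eval_le _ _))//.
  rewrite (@le_trans _ _ (`|v n - l| * (Num.sqrt (k y y) + 1)))//.
    by rewrite ler_wpM2l// lerDl.
  rewrite -ler_pdivlMr ?ltr_wpDl ?sqrtr_ge0//; near: n.
  by apply: cvgr_distC_le => //; rewrite divr_gt0 ?ltr_wpDl ?sqrtr_ge0.
move=> y; have := eval_cvg _ _ y gE; under eq_fun do rewrite evalm.
by move=> ev; apply: (norm_cvg_unique ev); exact: eval_cvg.
Unshelve. all: by end_near.
Qed.

End rkhs_theory.

(** * Integrals of Caratheodory functions *)

Lemma sfun_approx_id (R : realType) :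
  exists g : {sfun R >-> R}^nat, forall x : R, g n x @[n --> \oo] --> x.
Proof.
have [g gE] : exists g : {sfun R >-> R}^nat, forall x : R, setT x ->
    (EFin \o g ^~ x) n @[n --> \oo] --> x%:E.
  by apply: approximation_sfun => //; exact: measurable_EFin.
by exists g => x; have /fine_cvgP[] := gE x I.
Qed.

Section caratheodory.
Context {d : measure_display} {T : measurableType d} {R : realType}.
Variables (K : T -> R) (Psi : R -> T -> R).
Hypothesis mK : measurable_fun setT K.
Hypothesis mPsi : forall u, measurable_fun setT (Psi u).

Let cells (g : {sfun R >-> R}) (y : R) := K @^-1` (g @^-1` [set y]).

Let mcells g y : measurable (cells g y).
Proof. by rewrite -[cells g y]setTI; apply: mK. Qed.

Let measurable_fun_cells (g : {sfun R >-> R}) :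
  measurable_fun setT (fun w => Psi (g (K w)) w).
Proof.
move=> _ B mB; rewrite setTI.
have -> : (fun w => Psi (g (K w)) w) @^-1` B =
    \bigcup_(y in range g) (cells g y `&` (Psi y @^-1` B)).
  apply/seteqP; split => [w Bw|w [y _ []]]; last by rewrite /cells /= => ->.
  by exists (g (K w)).
apply: fin_bigcup_measurable => [|y _]; first exact: fimfunP.
by apply: measurableI => //; rewrite -[X in measurable X]setTI; exact: mPsi.
Qed.

(** With [K] replaced by simple approximations the function is measurable piece by piece; continuity
    in the first argument gives pointwise convergence. *)
Lemma measurable_fun_caratheodory : (forall w, continuous (Psi ^~ w)) ->
  measurable_fun setT (fun w => Psi (K w) w).
Proof.
move=> cPsi; have [g gE] := @sfun_approx_id R.
apply: (@measurable_fun_cvg _ _ _ _ (fun n w => Psi (g n (K w)) w)) => // w _.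
exact: (cvg_comp _ _ (gE (K w)) (cPsi w (K w))).
Qed.

(* Replacing [K] by a simple approximation makes [u] constant on finitely many
   events [K \in B]. *)
Lemma Rintegral_ge_caratheodory (P : probability T R) (V : T -> R) (m : R) :
    (forall w, continuous (Psi ^~ w)) ->
    P.-integrable setT (EFin \o V) -> (forall u w, `|Psi u w| <= V w) ->
    (forall u B, measurable B ->
      m * fine (P (K @^-1` B)) <= \int[P]_(w in K @^-1` B) Psi u w) ->
  m <= \int[P]_w Psi (K w) w.
Proof.
move=> cPsi iV PsiV mle; have [g gE] := @sfun_approx_id R.
pose F n w := Psi (g n (K w)) w.
have mF n : measurable_fun setT (F n) by exact: measurable_fun_cells.
have iF (G : T -> R) : measurable_fun setT G -> (forall w, `|G w| <= V w) ->
    P.-integrable setT (EFin \o G).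
  move=> mG GV; apply: le_integrable iV => //; first exact/measurable_EFinP.
  by move=> w _; rewrite lee_fin (le_trans (GV _))// ler_norm.
have mlim w : F n w @[n --> \oo] --> Psi (K w) w.
  by exact: (cvg_comp _ _ (gE (K w)) (cPsi w (K w))).
(* Dominated convergence with bound [V] reduces the claim to simple approximations of [K]. *)
have Fcvg : \int[P]_w F n w @[n --> \oo] --> \int[P]_w Psi (K w) w.
  have iPsi : P.-integrable setT (EFin \o (fun w => Psi (K w) w)).
    by apply: iF => //; exact: measurable_fun_caratheodory.
  apply: fine_cvg; rewrite fineK; last exact: integrable_fin_num.
  apply: (@dominated_cvg _ _ _ P setT measurableT _ _ (EFin \o V)) => //.
  - by move=> n; exact/measurable_EFinP.
  - by move=> w _; apply/fine_cvgP; split; [exact: nearW|exact: mlim].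
  - by move=> n w _; rewrite /= lee_fin; exact: PsiV.
apply: (ler_cvg_to (cvg_cst m) Fcvg); apply: nearW => n.
have /finite_seqP[s0 s0E] : finite_set (range (g n)) by exact: fimfunP.
pose s := undup s0.
have sE : \big[setU/set0]_(y <- s) cells (g n) y = setT.
  rewrite -bigcup_seq; apply/seteqP; split => // w _.
  exists (g n (K w)) => //=.
  rewrite mem_undup; have : range (g n) (g n (K w)) by exists (K w).
  by rewrite s0E.
have tI : trivIset [set` s] (cells (g n)).
  by move=> y z _ _ [w [/= <- <-]].
rewrite -lee_fin.
have intE (G : T -> R) : P.-integrable setT (EFin \o G) ->
    ((\int[P]_w G w)%:E = \sum_(y <- s) \int[P]_(w in cells (g n) y) (G w)%:E)%E.
  move=> iG; rewrite fineK ?integrable_fin_num// -{1}sE.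
  rewrite integral_bigsetU_EFin//; first exact: undup_uniq.
  by rewrite sE; exact: measurable_int iG.
(* As [P] has mass 1, [m] is an integral too, and both sides split over the cells. *)
have -> : m = \int[P]_w cst m w.
  rewrite Rintegral_cst// -[LHS]mulr1; congr (_ * _).
  by rewrite -[LHS]/(fine 1%E); congr fine; exact: (esym (probability_setT P)).
rewrite intE; last exact: finite_measure_integrable_cst.
rewrite intE; last exact: iF (mF n) (fun w => PsiV _ w).
apply: lee_sum => y _.
have -> : (\int[P]_(w in cells (g n) y) (cst m w)%:E = m%:E * P (cells (g n) y))%E.
  by rewrite -integral_cst.
(* On this cell the first argument is frozen at [y], so the hypothesis applies with [u = y]. *)
have -> : (\int[P]_(w in cells (g n) y) (F n w)%:E =
    \int[P]_(w in cells (g n) y) (Psi y w)%:E)%E.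
  by apply: eq_integral => w /[!inE]; rewrite /cells /F /= => ->.
rewrite -[X in (_ <= X)%E]fineK; last first.
  apply: integrable_fin_num => //; apply: integrableS (iF _ (mPsi y) (PsiV y)) => //.
rewrite -[X in (_ * X)%E]fineK ?fin_num_measure// -EFinM lee_fin.
exact: mle.
Qed.

End caratheodory.

Section orthogonality.
Context {d : measure_display} {T : measurableType d} {R : realType}.
Variable P : probability T R.

(* truncation of [x] to [-c, c] *)
Let clamp (c x : R) := 2^-1 * (`|x + c| - `|x - c|).

Let clamp_le c x : 0 <= c -> `|clamp c x| <= c.
Proof.
move=> c0; rewrite /clamp normrM ger0_norm// ler_pdivrMl// -[leRHS]ger0_norm ?mulr_ge0//.
rewrite (le_trans (ler_dist_dist _ _))//; have -> // : x + c - (x - c) = 2 * c by ring.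
Qed.

Let clamp_le_norm c x : `|clamp c x| <= `|x|.
Proof.
rewrite /clamp normrM ger0_norm// ler_pdivrMl// (distrC x).
rewrite (le_trans (ler_dist_dist _ _))//.
by have -> : x + c - (c - x) = 2 * x; [ring|rewrite normrM ger0_norm].
Qed.

Let clamp_id c x : `|x| <= c -> clamp c x = x.
Proof.
rewrite ler_norml => /andP[cx xc]; rewrite /clamp.
by rewrite ger0_norm ?ler0_norm; first field; lra.
Qed.

Let clamp_cont c : continuous (clamp c).
Proof.
move=> x; apply: cvgM; first exact: cvg_cst.
by apply: cvgB; apply: cvg_norm; apply: cvgD => //; exact: cvg_cst.
Qed.

(** For truncated [K], the inequality of [Rintegral_ge_caratheodory] with [m = 0] is applied to [D]
    and to [- D]; the truncation is then removed by dominated convergence. *)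
Lemma Rintegral_mul_eq0 (D K : T -> R) :
    measurable_fun setT K -> P.-integrable setT (EFin \o D) ->
    P.-integrable setT (EFin \o (fun w => D w * K w)) ->
    (forall B, measurable B -> \int[P]_(w in K @^-1` B) D w = 0) ->
  \int[P]_w (D w * K w) = 0.
Proof.
move=> mK iD iDK D0.
have mD : measurable_fun setT D by apply/measurable_EFinP; exact: measurable_int iD.
have mclamp c : measurable_fun setT (clamp c).
  by apply: continuous_measurable_fun; exact: clamp_cont.
have clamp0 c : 0 <= c -> \int[P]_w (D w * clamp c (K w)) = 0.
  move=> c0.
  have iV : P.-integrable setT (EFin \o (fun w => c * `|D w|)).
    have := integrableZl measurableT c (integrable_norm iD).
    by apply: eq_integrable => // w _ /=; rewrite EFinM.
  (* The signs [s = 1] and [s = -1] give the two inequalities. *)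
  have VE s : `|s| = 1 -> 0 <= \int[P]_w (s * D w * clamp c (K w)).
    move=> s1.
    apply: (@Rintegral_ge_caratheodory _ _ _ K (fun u w => s * D w * clamp c u) mK _ P
      (fun w => c * `|D w|)) => //.
    - by move=> u; apply: measurable_funM => //; exact: measurable_funM.
    - by move=> w x; apply: cvgM; [exact: cvg_cst|exact: clamp_cont].
    - by move=> u w; rewrite 2!normrM s1 mul1r mulrC ler_wpM2r// clamp_le.
    - move=> u B mB; rewrite mul0r.
      have mKB : measurable (K @^-1` B) by rewrite -[X in measurable X]setTI; exact: mK.
      have iDB : P.-integrable (K @^-1` B) (EFin \o D) by apply: integrableS iD.
      under eq_Rintegral do rewrite mulrAC.
      by rewrite RintegralZl// D0// mulr0.
  have iDc : P.-integrable setT (EFin \o (fun w => D w * clamp c (K w))).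
    apply: le_integrable iV => //.
      apply/measurable_EFinP; apply: measurable_funM => //.
      exact: measurableT_comp.
    move=> w _ /=; rewrite lee_fin normrM [leRHS]ger0_norm ?mulr_ge0// mulrC.
    by rewrite ler_wpM2r// clamp_le.
  apply/eqP; rewrite eq_le; apply/andP; split; last first.
    by have := VE 1 (normr1 _); under eq_Rintegral do rewrite mul1r.
  have := VE (-1) (normrN1 _); under eq_Rintegral do rewrite -mulrA.
  by rewrite RintegralZl// mulN1r oppr_ge0.
have Dcvg : \int[P]_w (D w * clamp n%:R (K w)) @[n --> \oo] --> \int[P]_w (D w * K w).
  apply: fine_cvg; rewrite fineK; last exact: integrable_fin_num.
  apply: (@dominated_cvg _ _ _ P setT measurableT _ _ (EFin \o (fun w => `|D w * K w|))) => //.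
  - move=> n; apply/measurable_EFinP; apply: measurable_funM => //.
    exact: measurableT_comp.
  - move=> w _; apply/fine_cvgP; split; first exact: nearW.
    apply: cvg_near_cst; near=> n; rewrite /= clamp_id//; near: n.
    exact: nbhs_infty_ger.
  - exact: integrable_norm.
  - by move=> n w _; rewrite /= lee_fin normrM (normrM (D w) (K w)) ler_wpM2l ?clamp_le_norm.
apply: (norm_cvg_unique Dcvg).
by apply: cvg_near_cst; apply: nearW => n; exact: clamp0.
Unshelve. all: by end_near.
Qed.

End orthogonality.

(** * Translation-invariant kernels *)

Definition upd_coord {R : realType} {p : nat} (x : 'rV[R]_p) (j : 'I_p) (u : R) :=
  \row_i (if i == j then u else x 0 i).

Section lq_kernel.
Context {R : realType} {mu : {finite_measure set R -> \bar R}} {q p : nat}.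
Hypothesis q0 : (0 < q)%N.
Implicit Types x y v : 'rV[R]_p.
Let k : 'rV[R]_p -> 'rV[R]_p -> R := @lq_kernel R mu q p.

Lemma lq_kernel_addr x y v : k (x + v) (y + v) = k x y.
Proof.
congr kernel_profile; apply: eq_bigr => i _.
by rewrite !mxE [in LHS]opprD addrACA subrr addr0.
Qed.

Lemma lq_kernel_diag x : k x x = kernel_profile mu 0.
Proof.
congr kernel_profile; rewrite big1// => i _.
by rewrite subrr normr0 expr0n (gtn_eqF q0).
Qed.

Lemma lq_kernel_upd x j u u' :
  k (upd_coord x j u) (upd_coord x j u') = kernel_profile mu (`|u - u'| ^+ q).
Proof.
congr kernel_profile; rewrite (bigD1 j)//= !mxE eqxx big1 ?addr0// => i /negPf ij.
by rewrite !mxE ij subrr normr0 expr0n (gtn_eqF q0).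
Qed.

(** For [t >= 0] the exponentials are bounded by 1, which is integrable since [mu] is finite. *)
Lemma kernel_profile_continuous0 :
  {for 0, continuous (fun u : R => kernel_profile mu (`|u| ^+ q))}.
Proof.
have mexp (u : R) : measurable_fun setT (fun t : R => expR (- (t * `|u| ^+ q))).
  apply: measurableT_comp; first exact: measurable_expR.
  by apply: measurable_funN; apply: measurable_funM.
have exp_le (u t : R) : `[0, +oo[%classic t -> `|expR (- (t * `|u| ^+ q))| <= 1.
  rewrite /= in_itv/= andbT => t0; rewrite ger0_norm ?expR_ge0//.
  by rewrite -expR0 ler_expR oppr_le0 mulr_ge0 ?exprn_ge0.
have i1 : mu.-integrable `[0, +oo[ (EFin \o cst (1 : R)).
  exact: finite_measure_integrable_cst.
apply: (@continuity_under_integral R _ _ mu (fun u t => expR (- (t * `|u| ^+ q)))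
  `[0, +oo[ (measurable_itv _) (-1) 1 _ _ (cst 1)) => //.
- move=> u _; apply: le_integrable i1 => //.
    by apply/measurable_EFinP; apply: measurable_funS (mexp u).
  by move=> t t0; rewrite /= lee_fin (le_trans (exp_le _ _ t0)) ?ler_norm.
- apply/aeW => t t0 u _.
  apply: (@continuous_comp _ _ _ (fun u : R => - (t * `|u| ^+ q)) expR);
    last exact: continuous_expR.
  apply: cvgN; apply: cvgM; first exact: cvg_cst.
  apply: (@continuous_comp _ _ _ (fun u : R => `|u|) (fun x : R => x ^+ q));
    last exact: exprn_continuous.
  exact: norm_continuous.
- by move=> u _; apply/aeW => t; exact: exp_le.
- by rewrite inE /= in_itv/= ltrN10 ltr01.
Qed.

Context {H : rkhs k}.

(** The shifts by [- v] and by [v] are adjoint for a translation-invariant kernel. *)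
Lemma rkhs_translate (f : H) v :
  exists g : H, `|g| = `|f| /\ forall y, rkhs_eval g y = rkhs_eval f (y + v).
Proof.
apply: (@rkhs_precomp _ _ _ H (fun x => x - v) (fun x => x + v)) => x y.
  exact: lq_kernel_addr.
by rewrite -(lq_kernel_addr _ _ v) subrK.
Qed.

Lemma rkhs_eval_bounded (f : H) x :
  `|rkhs_eval f x| <= `|f| * Num.sqrt (kernel_profile mu 0).
Proof. by rewrite -(lq_kernel_diag x) rkhs_eval_le. Qed.

(** By [rkhs_eval_lipschitz] the increment is controlled by the kernel profile near 0, through the
    bound [h] below. *)
Lemma rkhs_eval_continuous_upd (f : H) x j :
  continuous (fun u => rkhs_eval f (upd_coord x j u)).
Proof.
move=> u0; apply/cvgrPdist_le => e e0.
pose h u := `|f| * Num.sqrt (2 * kernel_profile mu 0 - 2 * kernel_profile mu (`|u - u0| ^+ q)).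
have h0 : h u @[u --> u0] --> 0.
  rewrite -[X in _ --> X](mulr0 `|f|) -sqrtr0; apply: cvgM; first exact: cvg_cst.
  apply: continuous_cvg; first exact: sqrt_continuous.
  rewrite -[X in _ --> X](subrr (2 * kernel_profile mu 0)).
  apply: cvgB; first exact: cvg_cst.
  apply: cvgM; first exact: cvg_cst.
  have kp : kernel_profile mu (`|u| ^+ q) @[u --> (0 : R)] --> kernel_profile mu 0.
    have E0 : `|0 : R| ^+ q = 0 by rewrite normr0 expr0n (gtn_eqF q0).
    by rewrite -[X in _ --> kernel_profile mu X]E0; exact: kernel_profile_continuous0.
  have du : (u - u0) @[u --> u0] --> (0 : R).
    by rewrite -[X in _ --> X](subrr u0); apply: cvgB => //; exact: cvg_cst.
  exact: (cvg_comp _ _ du kp).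
have /cvgrPdist_le/(_ e e0) := h0; apply: filterS => u; rewrite sub0r normrN => he.
rewrite distrC (le_trans (rkhs_eval_lipschitz _ _ _))//.
rewrite !lq_kernel_diag lq_kernel_upd (le_trans _ he)// (le_trans _ (ler_norm _))//.
rewrite le_eqVlt; apply/orP; left; apply/eqP; rewrite /h; congr (_ * Num.sqrt _); ring.
Qed.

End lq_kernel.

(** Induction on the number [n] of coordinates that follow [V], the others being frozen at [x]. Each
    step releases one coordinate by [measurable_fun_caratheodory]. *)
Lemma measurable_fun_separately_continuous {d} {T : measurableType d} {R : realType}
    {p : nat} (V : 'I_p -> T -> R) (F : 'rV[R]_p -> R) :
    (forall i, measurable_fun setT (V i)) ->
    (forall x j, continuous (fun u => F (upd_coord x j u))) ->
  measurable_fun setT (fun w => F (\row_i V i w)).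
Proof.
move=> mV cF.
suff mF n (x : 'rV[R]_p) :
    measurable_fun setT (fun w => F (\row_i (if (i < n)%N then V i w else x 0 i))).
  have := mF p 0; congr measurable_fun; apply/funext => w; congr F.
  by apply/rowP => i; rewrite !mxE ltn_ord.
elim: n x => [|n IH] x.
  have := @measurable_cst _ _ T R setT (F x); congr measurable_fun.
  by apply/funext => w; congr F; apply/rowP => i; rewrite mxE.
case: (ltnP n p) => [np|pn]; last first.
  have := IH x; congr measurable_fun; apply/funext => w; congr F.
  by apply/rowP => i; rewrite !mxE !(leq_trans (ltn_ord i))// ltnW.
pose j := Ordinal np.
pose Psi u w := F (upd_coord (\row_i (if (i < n)%N then V i w else x 0 i)) j u).
have -> : (fun w => F (\row_i (if (i < n.+1)%N then V i w else x 0 i))) =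
    (fun w => Psi (V j w) w).
  apply/funext => w; congr F; apply/rowP => i; rewrite !mxE -val_eqE/= ltnS leq_eqVlt.
  by case: eqP => [ij|//]; rewrite (_ : i = j)//; exact: val_inj.
apply: measurable_fun_caratheodory => // [u|w]; last exact: cF.
(* Freezing coordinate [j] at [u] is the previous stage with base point [upd_coord x j u]. *)
have := IH (upd_coord x j u); congr measurable_fun; apply/funext => w; congr F.
apply/rowP => i; rewrite !mxE -val_eqE/=.
by case: eqP => // ->; rewrite ltnn.
Qed.

(** * Independence of the signal and the noise variables *)

Section independence.
Context {d : measure_display} {T : measurableType d} {R : realType}.
Variable P : probability T R.
Implicit Types (A C E : set T) (D G K : T -> R).

Lemma Rintegral_setI_indic E C G :
  \int[P]_(w in E `&` C) G w = \int[P]_(w in E) (G w * \1_C w).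
Proof. by rewrite Rintegral_mkcondr patch_indic. Qed.

Lemma Rintegral_indic E C : measurable E -> measurable C ->
  \int[P]_(w in E) \1_C w = fine (P (C `&` E)).
Proof. by move=> mE mC; rewrite /Rintegral integral_indic. Qed.

Lemma Rintegral1 E : measurable E -> \int[P]_(w in E) 1 = fine (P E).
Proof. by move=> mE; rewrite Rintegral_cst// mul1r. Qed.

Lemma integrable_mul_indic C G : measurable C ->
  P.-integrable setT (EFin \o G) ->
  P.-integrable setT (EFin \o (fun w => G w * \1_C w)).
Proof.
move=> mC iG; apply: le_integrable (iG) => //.
  apply/measurable_EFinP; apply: measurable_funM => //.
  by apply/measurable_EFinP; exact: measurable_int iG.
move=> w _ /=; rewrite lee_fin normrM ler_piMr// indicE.
by case: (w \in C); rewrite ?normr0 ?normr1.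
Qed.

Lemma integrable_scale (c : R) G : P.-integrable setT (EFin \o G) ->
  P.-integrable setT (EFin \o (fun w => c * G w)).
Proof.
move=> iG; have := integrableZl measurableT c iG.
by apply: eq_integrable => // w _ /=; rewrite EFinM.
Qed.

Lemma integrable_sub G K : P.-integrable setT (EFin \o G) ->
    P.-integrable setT (EFin \o K) ->
  P.-integrable setT (EFin \o (fun w => G w - K w)).
Proof.
move=> iG iK; have := integrableB measurableT iG iK.
by apply: eq_integrable => // w _ /=; rewrite EFinB.
Qed.

(** By assumption [D * \1_C - P(C) * D] integrates to 0 over every event of the sigma-algebra of
    [K], so [Rintegral_mul_eq0] makes it orthogonal to [K]. *)
Lemma Rintegral_mul_indep D K C : measurable C -> measurable_fun setT K ->
    P.-integrable setT (EFin \o D) ->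
    P.-integrable setT (EFin \o (fun w => D w * K w)) ->
    (forall B, measurable B -> \int[P]_(w in K @^-1` B `&` C) D w =
      fine (P C) * \int[P]_(w in K @^-1` B) D w) ->
  \int[P]_(w in C) (D w * K w) = fine (P C) * \int[P]_w (D w * K w).
Proof.
move=> mC mK iD iDK indep; set c := fine (P C).
pose D' w := D w * \1_C w - c * D w.
have iD' : P.-integrable setT (EFin \o D').
  by apply: integrable_sub; [exact: integrable_mul_indic|exact: integrable_scale].
have DK'E : (fun w => D' w * K w) =
    (fun w => (D w * K w) * \1_C w - c * (D w * K w)).
  by apply/funext => w; rewrite /D'; ring.
have i1 := integrable_mul_indic mC iDK.
have i2 := integrable_scale c iDK.
have : \int[P]_w (D' w * K w) = 0.
  apply: Rintegral_mul_eq0 => //; first by rewrite DK'E; exact: integrable_sub.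
  move=> B mB.
  have mKB : measurable (K @^-1` B) by rewrite -[X in measurable X]setTI; exact: mK.
  have sub G : P.-integrable setT (EFin \o G) -> P.-integrable (K @^-1` B) (EFin \o G).
    by apply: integrableS.
  rewrite /D' RintegralB//; [|exact/sub/integrable_mul_indic|exact/sub/integrable_scale].
  by rewrite -Rintegral_setI_indic indep// RintegralZl ?subrr//; exact: sub.
rewrite DK'E RintegralB// RintegralZl// -Rintegral_setI_indic setTI.
by move/eqP; rewrite subr_eq0 => /eqP.
Qed.

End independence.

Section signal.
Context {d : measure_display} {T : measurableType d} {R : realType}.
Context {P : probability T R} {p : nat} {X : 'I_p -> {RV P >-> R}}.
Implicit Types (S A : {set 'I_p}) (B C : set T).

Lemma sigma_subvecE S B : sigma_subvec X S B <->
  exists2 E, measurable E & subvec X S @^-1` E = B.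
Proof.
rewrite /sigma_subvec /g_sigma_algebra_preimage /preimage_set_system.
by split=> -[E mE <-]; exists E => //; rewrite setTI.
Qed.

Lemma measurable_subvec S : measurable_fun setT (subvec X S).
Proof.
apply/measurable_fun_tnthP => i; rewrite /comp.
by under eq_fun do rewrite tnth_mktuple; exact: measurable_funPT.
Qed.

Lemma sigma_subvec_measurable S B : sigma_subvec X S B -> measurable B.
Proof.
move=> /sigma_subvecE[E mE <-]; rewrite -[X in measurable X]setTI.
exact: measurable_subvec.
Qed.

Lemma sigma_subvecI S B C :
  sigma_subvec X S B -> sigma_subvec X S C -> sigma_subvec X S (B `&` C).
Proof.
move=> /sigma_subvecE[E mE <-] /sigma_subvecE[F mF <-].
by apply/sigma_subvecE; exists (E `&` F) => //; exact: measurableI.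
Qed.

Lemma sigma_subvecS S A B : S \subset A -> sigma_subvec X S B -> sigma_subvec X A B.
Proof.
move=> SA /sigma_subvecE[E mE <-].
have SAj (j : 'I_#|S|) : enum_val j \in A by rewrite (fintype.subsetP SA)// enum_valP.
(* [r] extracts the coordinates in [S] from those in [A]. *)
pose r (t : #|A|.-tuple R) := [tuple tnth t (enum_rank_in (SAj j) (enum_val j)) | j < #|S|].
have mr : measurable_fun setT r.
  apply/measurable_fun_tnthP => i; rewrite /comp.
  by under eq_fun do rewrite tnth_mktuple; exact: measurable_tnth.
apply/sigma_subvecE; exists (r @^-1` E).
  by rewrite -[X in measurable X]setTI; exact: mr.
have rE w : r (subvec X A w) = subvec X S w.
  by apply: eq_from_tnth => j; rewrite !tnth_mktuple enum_rankK_in.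
by apply/seteqP; split => w /=; rewrite rE.
Qed.

Lemma sigma_subvec1 S l (B : set R) : l \in S -> measurable B -> sigma_subvec X S (X l @^-1` B).
Proof.
move=> lS mB; apply/sigma_subvecE.
exists ((fun t => tnth t (enum_rank_in lS l)) @^-1` B).
  by rewrite -[X in measurable X]setTI; exact: measurable_tnth.
by apply/seteqP; split => w /=; rewrite tnth_mktuple enum_rankK_in.
Qed.

(** On events of the sigma-algebra of [X] the response may be replaced by [Z], hence almost surely
    by [Z'], which depends on [X_S] only and is therefore independent of [C]. *)
Lemma Rintegral_response_indep (Y : T -> R) S B C :
    mean_sufficient X Y S -> indep_compl X S ->
    sigma_subvec X S B -> sigma_subvec X (~: S)%SET C ->
  \int[P]_(w in B `&` C) Y w = fine (P C) * \int[P]_(w in B) Y w.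
Proof.
move=> [Z [Z' [[iY _ iZ YZ] [_ sZ' iZ' YZ'] ZZ']]] indS sB sC.
have mB := sigma_subvec_measurable sB; have mC := sigma_subvec_measurable sC.
have -> : \int[P]_(w in B) Y w = \int[P]_(w in B) Z' w.
  by rewrite /Rintegral YZ'.
have -> : \int[P]_(w in B `&` C) Y w = \int[P]_(w in B `&` C) Z' w.
  rewrite /Rintegral -YZ; last first.
    by apply: sigma_subvecI; [apply: sigma_subvecS sB|apply: sigma_subvecS sC]; exact: finset.subsetT.
  congr fine; apply: ae_eq_integral => //.
  - exact: measurableI.
  - by apply: measurable_funS (measurable_int _ iZ).
  - by apply: measurable_funS (measurable_int _ iZ').
  - by apply: filterS ZZ' => w /= -> _.
have eqB (G : T -> R) E : \int[P]_(w in B `&` E) G w = \int[P]_(w in E) (\1_B w * G w).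
  by rewrite setIC Rintegral_setI_indic; under eq_Rintegral do rewrite mulrC.
rewrite eqB -[in RHS](setIT B) eqB.
have i1 : P.-integrable setT (EFin \o cst (1 : R)).
  exact: finite_measure_integrable_cst.
(* Here [D] is [\1_B] and [K] is [Z']; the hypothesis becomes independence of [C] from the
   intersections of [B] with events of [Z']. *)
apply: Rintegral_mul_indep => //.
- by apply/measurable_EFinP; exact: measurable_int iZ'.
- have := integrable_mul_indic mB i1; apply: eq_integrable => // w _ /=.
  by rewrite mul1r.
- have := integrable_mul_indic mB iZ'; apply: eq_integrable => // w _ /=.
  by rewrite mulrC.
move=> E mE; have sE : sigma_subvec X S (Z' @^-1` E).
  by apply: sZ'; exists E => //; rewrite setTI.
have mZE := sigma_subvec_measurable sE.
rewrite !Rintegral_indic//; last exact: measurableI.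
rewrite setIA (indS _ _ (sigma_subvecI sB sE) sC) muleC fineM//; apply: fin_num_measure => //.
exact: measurableI.
Qed.

End signal.

(** * Monotonicity of the objective *)

Section square_loss.
Context {d : measure_display} {T : measurableType d} {R : realType}.
Variables (P : probability T R) (Y : T -> R) (c : R).
Hypothesis iY : P.-integrable setT (EFin \o Y).
Hypothesis iY2 : P.-integrable setT (EFin \o (fun w => Y w ^+ 2)).

(** A dominating function, uniform over predictors [G] bounded by [c], for the part of the square
    loss that involves [G]. *)
Definition loss_bound w := c ^+ 2 + (2 * c) * `|Y w|.

Lemma integrable_loss_bound : P.-integrable setT (EFin \o loss_bound).
Proof.
have i1 : P.-integrable setT (EFin \o cst (c ^+ 2)).
  exact: finite_measure_integrable_cst.
have := integrableD measurableT i1 (integrable_scale (2 * c) (integrable_norm iY)).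
by apply: eq_integrable => // w _ /=; rewrite EFinD.
Qed.

Variable G : T -> R.
Hypothesis mG : measurable_fun setT G.
Hypothesis Gc : forall w, `|G w| <= c.

Lemma integrable_sqr_bounded : P.-integrable setT (EFin \o (fun w => G w ^+ 2)).
Proof.
have ic : P.-integrable setT (EFin \o cst (c ^+ 2)).
  exact: finite_measure_integrable_cst.
apply: le_integrable ic => //; first by apply/measurable_EFinP; exact: measurable_funX.
move=> w _ /=; rewrite lee_fin normrX [leRHS]ger0_norm ?sqr_ge0//.
by rewrite lerXn2r ?nnegrE// (le_trans _ (Gc w)).
Qed.

Lemma integrable_mul_bounded : P.-integrable setT (EFin \o (fun w => Y w * G w)).
Proof.
apply: le_integrable (integrable_scale c (integrable_norm iY)) => //.
  apply/measurable_EFinP; apply: measurable_funM => //.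
  by apply/measurable_EFinP; exact: measurable_int iY.
move=> w _ /=; rewrite lee_fin normrM normrM normr_id mulrC ler_wpM2r//.
by rewrite (le_trans (Gc w))// ler_norm.
Qed.

Lemma Rintegral_square_loss :
  \int[P]_w (Y w - G w) ^+ 2 =
  \int[P]_w (Y w ^+ 2) + \int[P]_w (G w ^+ 2 - 2 * (Y w * G w)).
Proof.
rewrite -RintegralD//; last first.
  apply: integrable_sub; first exact: integrable_sqr_bounded.
  by apply: integrable_scale; exact: integrable_mul_bounded.
by apply: eq_Rintegral => w _; ring.
Qed.

Lemma loss_le w : `|G w ^+ 2 - 2 * (Y w * G w)| <= loss_bound w.
Proof.
rewrite (le_trans (ler_normB _ _))// lerD//.
  by rewrite normrX lerXn2r ?nnegrE// (le_trans _ (Gc w)).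
by rewrite normrM ger0_norm// -mulrA ler_wpM2l// normrM mulrC ler_wpM2r.
Qed.

End square_loss.

Section objective_monotone.
Context {d : measure_display} {T : measurableType d} {R : realType}.
Context {P : probability T R} {p : nat} {X : 'I_p -> {RV P >-> R}} {Y : {RV P >-> R}}.
Context {S : {set 'I_p}} {q : nat} {mu : {finite_measure set R -> \bar R}}.
Context {H : rkhs (@lq_kernel R mu q p)}.
Variable lambda : R.
Hypothesis q0 : (0 < q)%N.
Hypothesis lambda_ge0 : 0 <= lambda.
Hypothesis iY2 : P.-integrable setT (EFin \o (fun w => Y w ^+ 2)).
Hypothesis msS : mean_sufficient X Y S.
Hypothesis indS : indep_compl X S.

Let iY : P.-integrable setT (EFin \o Y).
Proof. by have [Z [Z' [[]]]] := msS. Qed.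

Lemma krr_riskE b (f : H) : krr_risk X Y q lambda b f =
  2^-1 * \int[P]_w (Y w - rkhs_eval f (scale_vec q b (rvec X w))) ^+ 2
  + lambda / 2 * `|f| ^+ 2.
Proof. by rewrite /krr_risk unlock. Qed.

Lemma krr_risk_ge0 b (f : H) : 0 <= krr_risk X Y q lambda b f.
Proof.
rewrite krr_riskE addr_ge0// mulr_ge0 ?divr_ge0 ?sqr_ge0//.
by apply: Rintegral_ge0 => w _; exact: sqr_ge0.
Qed.

Lemma objJ_le b (f : H) : objJ X Y q H lambda b <= krr_risk X Y q lambda b f.
Proof.
apply: ge_inf; last by exists f.
by exists 0 => _ [g _ <-]; exact: krr_risk_ge0.
Qed.

Lemma objJ_noise_monotone (b : 'rV[R]_p) l (h : R) : (forall i, i \notin S -> b 0 i = 0) ->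
  l \notin S -> 0 <= h ->
  objJ X Y q H lambda b <= objJ X Y q H lambda (b + h *: delta_mx 0 l).
Proof.
move=> bS lS h0; set b' := b + _.
apply: lb_le_inf => [|_ [f _ <-]]; first by exists (krr_risk X Y q lambda b' (0 : H)), 0.
have q1 : (q%:R^-1 : R) != 0 by rewrite invr_eq0 pnatr_eq0 lt0n_neq0.
(* The factor of [X l] in the scaled input at [b'], since [b 0 l = 0]. *)
pose a := h `^ q%:R^-1.
pose x0 w : 'rV[R]_p := scale_vec q b (rvec X w).
pose c := `|f| * Num.sqrt (kernel_profile mu 0).
(* The prediction of [f] at [b'] with [X l] frozen at [u]. *)
pose G u w := rkhs_eval f (upd_coord (x0 w) l (a * u)).
have x0S w i : i \notin S -> x0 w 0 i = 0.
  by move=> iS; rewrite !mxE bS// powR0// mul0r.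
have Gc u w : `|G u w| <= c by exact: rkhs_eval_bounded.
(* The argument of [f] in [G u], as a function of [X_S] alone: coordinates outside [S] other than
   [l] are 0. *)
pose V u i (t : #|S|.-tuple R) := if i == l then a * u else
  if [pick j | enum_val j == i] is Some j then b 0 i `^ q%:R^-1 * tnth t j else 0.
pose phi u t := rkhs_eval f (\row_i V u i t).
have mphi u : measurable_fun setT (phi u).
  apply: measurable_fun_separately_continuous => [i|x j]; last first.
    exact: rkhs_eval_continuous_upd.
  rewrite /V; case: eqP => // _; case: pickP => // j _.
  by apply: measurable_funM => //; exact: measurable_tnth.
have GE u : G u = phi u \o subvec X S.
  apply/funext => w; congr rkhs_eval; apply/rowP => i; rewrite !mxE /V.
  case: eqP => // _; case: pickP => [j /eqP <-|noj]; first by rewrite tnth_mktuple.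
  have iS : i \notin S.
    apply/negP => iS; have := noj (enum_rank_in iS i).
    by rewrite enum_rankK_in ?eqxx.
  by have := x0S w i iS; rewrite !mxE.
have mG u : measurable_fun setT (G u).
  by rewrite GE; apply: measurableT_comp => //; exact: measurable_subvec.
pose Psi u w := G u w ^+ 2 - 2 * (Y w * G u w).
(* The translate of [f] by [a * u] along coordinate [l] predicts at [b] what [G u] predicts, at the
   same norm, so it competes in [objJ] at [b]. *)
have risk_shift u : objJ X Y q H lambda b <=
    2^-1 * (\int[P]_w Y w ^+ 2 + \int[P]_w Psi u w) + lambda / 2 * `|f| ^+ 2.
  have [g [gf gE]] := rkhs_translate f (a * u *: delta_mx 0 l).
  apply: le_trans (objJ_le _ g) _; rewrite krr_riskE gf lerD2r ler_wpM2l//.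
  rewrite -(Rintegral_square_loss iY iY2 (mG u) (Gc u)).
  rewrite le_eqVlt; apply/orP; left; apply/eqP; apply: eq_Rintegral => w _.
  rewrite gE; congr ((_ - rkhs_eval f _) ^+ 2); apply/rowP => i.
  rewrite -/(x0 w) [in RHS]mxE mxE [X in _ + X]mxE [X in _ * X]mxE eqxx/=.
  by case: eqP => [->|_] /=; rewrite ?(x0S w l lS) ?mulr1 ?add0r ?mulr0 ?addr0.
(* The bound [risk_shift] solved for the integral of [Psi u]; it does not depend on [u]. *)
pose m := 2 * (objJ X Y q H lambda b - lambda / 2 * `|f| ^+ 2) - \int[P]_w Y w ^+ 2.
have cG w : continuous (G ^~ w).
  move=> u; apply: (@continuous_comp _ _ _ (fun u => a * u)
    (fun u => rkhs_eval f (upd_coord (x0 w) l u))); last exact: rkhs_eval_continuous_upd.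
  by apply: cvgM; [exact: cvg_cst|exact: cvg_id].
have mGX : measurable_fun setT (fun w => G (X l w) w).
  by apply: measurable_fun_caratheodory => //; exact: measurable_funPT.
have mPsi u : measurable_fun setT (Psi u).
  apply: measurable_funB; first exact: measurable_funX.
  by apply: measurable_funM => //; apply: measurable_funM => //; exact: measurable_funPT.
(* The square is a function of [X_S], so independence suffices for it; the cross term with [Y] also
   uses mean sufficiency. *)
have Psi_indep u C : sigma_subvec X (~: S)%SET C ->
    \int[P]_(w in C) Psi u w = fine (P C) * \int[P]_w Psi u w.
  move=> sC; have mC := sigma_subvec_measurable sC.
  have sG B : measurable B -> sigma_subvec X S (G u @^-1` B).
    move=> mB; apply/sigma_subvecE; exists (phi u @^-1` B); last by rewrite GE.
    by rewrite -[X in measurable X]setTI; exact: mphi.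
  have iG2 := integrable_sqr_bounded P (mG u) (Gc u).
  have iYG := integrable_mul_bounded iY (mG u) (Gc u).
  have G2 : \int[P]_(w in C) G u w ^+ 2 = fine (P C) * \int[P]_w G u w ^+ 2.
    have i1 : P.-integrable setT (EFin \o cst (1 : R)).
      exact: finite_measure_integrable_cst.
    have E E' : \int[P]_(w in E') G u w ^+ 2 = \int[P]_(w in E') (cst 1 w * G u w ^+ 2).
      by apply: eq_Rintegral => w _; rewrite mul1r.
    rewrite !E; apply: Rintegral_mul_indep => //; first exact: measurable_funX.
      by apply: eq_integrable iG2 => // w _ /=; rewrite mul1r.
    move=> B mB; have sGB : sigma_subvec X S ((fun w => G u w ^+ 2) @^-1` B).
      have := sG ((fun x : R => x ^+ 2) @^-1` B); apply.
      by rewrite -[X in measurable X]setTI; exact: measurable_funX.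
    have mGB := sigma_subvec_measurable sGB.
    rewrite !Rintegral1//; last exact: measurableI.
    by rewrite (indS sGB sC) muleC fineM// fin_num_measure.
  have YG : \int[P]_(w in C) (Y w * G u w) = fine (P C) * \int[P]_w (Y w * G u w).
    apply: Rintegral_mul_indep => // B mB.
    exact: Rintegral_response_indep (sG B mB) sC.
  have sub K : P.-integrable setT (EFin \o K) -> P.-integrable C (EFin \o K).
    by apply: integrableS.
  rewrite /Psi RintegralB//; [|exact: sub|exact/sub/integrable_scale].
  rewrite RintegralB//; last exact: integrable_scale.
  by rewrite !RintegralZl// ?G2 ?YG; [ring|exact: sub].
have main : m <= \int[P]_w Psi (X l w) w.
  apply: (Rintegral_ge_caratheodory (measurable_funPT (X l)) mPsi _
    (integrable_loss_bound c iY)).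
  - move=> w u; apply: cvgB; first by apply: cvgM; exact: cG.
    by do 2 (apply: cvgM; first exact: cvg_cst); exact: cG.
  - by move=> u w; exact: loss_le.
  - move=> u B mB; rewrite Psi_indep; last by apply: sigma_subvec1 => //; rewrite inE.
    rewrite mulrC ler_wpM2l ?fine_ge0//.
    by have := risk_shift u; rewrite /m; lra.
rewrite krr_riskE.
have -> : \int[P]_w (Y w - rkhs_eval f (scale_vec q b' (rvec X w))) ^+ 2 =
    \int[P]_w (Y w - G (X l w) w) ^+ 2.
  apply: eq_Rintegral => w _; congr ((_ - rkhs_eval f _) ^+ 2); apply/rowP => i.
  rewrite !mxE eqxx/=.
  by case: eqP => [->|_] /=; rewrite ?(bS l lS) ?mulr1 ?add0r ?mulr0 ?addr0.
rewrite (Rintegral_square_loss iY iY2 mGX (fun w => Gc (X l w) w)).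
by move: main; rewrite /m /Psi; lra.
Qed.

End objective_monotone.

(** * Sign of the partial derivatives and the projection step *)

Lemma partial_deriv_ge0 {R : realType} {p : nat} (F : 'rV[R]_p -> R) (b : 'rV[R]_p) l :
    b 0 l = 0 -> (forall h, 0 < h -> F b <= F (b + h *: delta_mx 0 l)) ->
  0 <= partial_deriv F b l.
Proof.
move=> bl Fb; rewrite /partial_deriv bl eqxx.
(* a divergent [lim] is [point], which is [0] here *)
set D := (X in lim X); have [cD|/dvgP->//] := pselect (cvg D).
apply: limr_ge => //; near=> h.
have h0 : 0 < h by near: h; exact: nbhs_right_gt.
by rewrite mulr_ge0 ?invr_ge0 ?(ltW h0)// subr_ge0 Fb.
Unshelve. all: by end_near.
Qed.

(** If the projection had a positive coordinate [l], setting it to 0 would stay in the ball and come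
    strictly closer to [x]. *)
Lemma euclidean_proj_l1ball_eq0 {R : realType} {p : nat} (M : R) (x : 'rV[R]_p) l :
  x 0 l <= 0 -> euclidean_proj (l1ball_nonneg M) x 0 l = 0.
Proof.
move=> xl; rewrite /euclidean_proj; set Q := [set b | _].
(* Without a minimiser, [get] returns the default point, whose coordinates are 0. *)
have [Q0|Q0] := pselect (exists b, Q b); last first.
  by rewrite getPN ?mxE// => b Qb; apply: Q0; exists b.
have := getPex Q0; set b := get Q => -[[b0 bM] bmin].
apply/eqP; rewrite eq_le b0 andbT leNgt; apply/negP => bl.
have cl i : upd_coord b l 0 0 i = if i == l then 0 else b 0 i by rewrite mxE.
have /bmin : l1ball_nonneg M (upd_coord b l 0).
  split=> [i|]; first by rewrite cl; case: eqP.
  apply: le_trans bM; apply: ler_sum => i _.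
  by rewrite cl; case: eqP => // _; rewrite normr0.
(* Strict comparison of square roots needs a positive right-hand sum; its term at [l] is nonzero
   because [x 0 l <= 0 < b 0 l]. *)
apply/negP; rewrite -ltNge ltr_sqrt; last first.
  rewrite (bigD1 l)//= ltr_pwDl ?sumr_ge0// => [|i _]; last exact: sqr_ge0.
  by rewrite exprn_even_gt0//= !mxE subr_eq0 lt_eqF// (le_lt_trans xl).
rewrite (bigD1 l)//= [ltRHS](bigD1 l)//=.
rewrite (eq_bigr (fun i => (x - b) 0 i ^+ 2)) => [|i /negPf il]; last first.
  by rewrite [in LHS]mxE [in LHS]mxE cl il !mxE.
rewrite ltrD2r !mxE eqxx; nra.
Qed.

(** * Zero coordinates along the iterates and at their accumulation points *)

Theorem theorem1 (d : measure_display) (T : measurableType d) (R : realType)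
    (P : probability T R) (p : nat)
    (X : 'I_p -> {RV P >-> R}) (Y xi : {RV P >-> R})
    (S : {set 'I_p}) (fstar : {mfun #|S|.-tuple R >-> R})
    (q : nat) (mu : {finite_measure set R -> \bar R})
    (H : rkhs (@lq_kernel R mu q p))
    (MX MY lambda gamma M alpha : R)
    (beta : nat -> 'rV[R]_p) (betastar : 'rV[R]_p)
    (* model *)
    (EY0 : ('E_P[Y] = 0)%E)
    (Ymodel : forall w, Y w = fstar (subvec X S w) + xi w)
    (xi0 : is_cond_expectation P (sigma_subvec X [set: 'I_p]%SET) xi (cst 0))
    (Ssignal : is_signal_set X Y S)
    (* kernel *)
    (q12 : q = 1%N \/ q = 2%N)
    (mu_nonneg : mu `]-oo, (0 : R)%R[%classic = 0%E)
    (mu_pos : (0 < mu `](0 : R)%R, +oo[%classic)%E)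
    (mu_inv : (\int[mu]_(t in `[0%R, +oo[) (t%:E)^-1 < +oo)%E)
    (mu_compact : compact (msupport mu))
    (mu_q2 : q = 2%N -> ~ msupport mu 0)
    (* moments and parameters *)
    (X4 : forall l, ('E_P[(fun w => X l w ^+ 4)%R] <= (MX ^+ 4)%:E)%E)
    (Y2 : ('E_P[(fun w => Y w ^+ 2)%R] <= (MY ^+ 2)%:E)%E)
    (lambda_gt0 : 0 < lambda) (gamma_ge0 : 0 <= gamma)
    (M_ge0 : 0 <= M) (alpha_gt0 : 0 < alpha)
    (* projected gradient descent *)
    (beta0 : beta 0%N = 0)
    (betaS : forall n, beta n.+1 =
      euclidean_proj (l1ball_nonneg M)
        (beta n - alpha *: gradient (objJ_gamma X Y q H lambda gamma) (beta n)))
    (beta_acc : cluster (beta @ \oo) betastar) :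
  forall l, l \notin S -> betastar 0 l = 0.
Proof.
have q0 : (0 < q)%N by case: q12 => ->.
have [msS indS] : mean_sufficient X Y S /\ indep_compl X S.
  by case: Ssignal => /minsetp /asboolP.
have iY2 : P.-integrable setT (EFin \o (fun w => Y w ^+ 2)).
  apply/integrableP; split.
    by apply/measurable_EFinP; apply: measurable_funX; exact: measurable_funPT.
  apply: le_lt_trans (ltry (MY ^+ 2)); apply: le_trans Y2; rewrite unlock.
  rewrite le_eqVlt; apply/orP; left; apply/eqP; apply: eq_integral => w _ /=.
  by rewrite ger0_norm ?sqr_ge0.
have betaN n l : l \notin S -> beta n 0 l = 0.
  elim: n l => [|n IH] l lS; first by rewrite beta0 mxE.
  rewrite betaS; apply: euclidean_proj_l1ball_eq0; rewrite !mxE IH// sub0r oppr_le0.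
  rewrite mulr_ge0 ?(ltW alpha_gt0)//; apply: partial_deriv_ge0; first exact: IH.
  move=> h h0; rewrite /objJ_gamma lerD//.
    by apply: (objJ_noise_monotone q0 (ltW lambda_gt0) iY2 msS indS) => //; exact: ltW.
  (* The penalty cannot decrease either: only coordinate [l] changes, starting from 0. *)
  rewrite ler_wpM2l//; apply: ler_sum => i _; rewrite !mxE eqxx/=.
  by case: eqP => [->|_] /=; rewrite ?mulr0 ?addr0// IH// normr0.
(* Vanishing of coordinate [l] is a closed condition, so it passes to cluster points. *)
move=> l lS; apply/eqP; apply: contrapT => /negP bl.
have FA : (beta @ \oo) [set v : 'rV[R]_p | v 0 l = 0].
  by exists 0%N => // n _; exact: betaN.
have : nbhs betastar [set v : 'rV[R]_p | v 0 l != 0].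
  have /= := @coord_continuous R 1 p 0 l betastar.
  move=> /(_ [set u | u != 0]); apply.
  by apply: open_nbhs_nbhs; split => //; exact: open_neq.
by move=> /(beta_acc _ _ FA) [v [/= ->]]; rewrite eqxx.
Qed.
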